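(* Let $I\subset S$ be a nonzero proper graded ideal. Then for every $\mathfrak{p}\in\operatorname{Ass}^\infty(I)$ the function $k\mapsto \mathrm{v}_\mathfrak{p}(I^k)$ is a linear function of $k$ for $k\gg0$ (i.e. there are integers $a_\mathfrak{p},b_\mathfrak{p}$ with $\mathrm{v}_\mathfrak{p}(I^k)=a_\mathfrak{p}k+b_\mathfrak{p}$ for all $k\gg0$), and the function $k\mapsto\mathrm{v}(I^k)$ is a linear function of $k$ for $k\gg0$.
   Context: $S=K[x_1,\dots,x_n]$ is a standard graded polynomial ring over a field $K$, $S_d$ its degree-$d$ component, $\mathfrak{m}=(x_1,\dots,x_n)$. For a graded ideal $I\subset S$ and $\mathfrak{p}\in\operatorname{Ass}(I)$, the v-number of $I$ at $\mathfrak{p}$ is $\mathrm{v}_\mathfrak{p}(I)=\min\{d:\exists f\in S_d \text{ with } (I:f)=\mathfrak{p}\}$, and the v-number of $I$ is $\mathrm{v}(I)=\min\{d:\exists f\in S_d\text{ with }(I:f)\in\operatorname{Ass}(I)\}$. By Brodmann's theorem $\operatorname{Ass}(I^k)=\operatorname{Ass}(I^{k+1})$ for $k\gg0$; this eventual common set is denoted $\operatorname{Ass}^\infty(I)$ (the stable primes of $I$). *)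

(* Defs.v *)
From HB Require Import structures.
From mathcomp Require Import all_boot all_order all_algebra.
From mathcomp Require Export mpoly.

Set Implicit Arguments.
Unset Strict Implicit.
Unset Printing Implicit Defensive.

Import GRing.Theory.
Local Open Scope ring_scope.

Section Ideals.
Variables (K : fieldType) (n : nat).
Local Notation S := {mpoly K[n]}.

Definition same_set (I J : S -> Prop) : Prop := forall g, I g <-> J g.

Definition is_ideal (I : S -> Prop) : Prop :=
  [/\ I 0,
      (forall f g, I f -> I g -> I (f + g)) &
      (forall a f, I f -> I (a * f))].

Definition is_graded_ideal (I : S -> Prop) : Prop :=
  is_ideal I /\ forall f d, I f -> I (pihomog mdeg d f).

Definition is_prime_ideal (P : S -> Prop) : Prop :=
  [/\ is_ideal P, ~ P 1 & forall a b, P (a * b) -> P a \/ P b].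

Definition ideal_mul (I J : S -> Prop) : S -> Prop :=
  fun f => exists s : seq (S * S),
    (forall x, x \in s -> I x.1 /\ J x.2) /\ f = \sum_(x <- s) x.1 * x.2.

Fixpoint ideal_pow (I : S -> Prop) (k : nat) : S -> Prop :=
  match k with
  | 0%N => fun _ => True
  | k'.+1 => ideal_mul (ideal_pow I k') I
  end.

Definition colon (I : S -> Prop) (f : S) : S -> Prop := fun g => I (g * f).

Definition is_ass (I : S -> Prop) (P : S -> Prop) : Prop :=
  is_prime_ideal P /\ exists f : S, same_set (colon I f) P.

(* P is a stable prime of I: P in Ass^oo(I), the eventual common value of
   Ass(I^k) (which exists by Brodmann). *)
Definition is_stable_ass (I : S -> Prop) (P : S -> Prop) : Prop :=
  exists k0 : nat, (forall k, (k0 <= k)%N ->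
      forall Q, is_ass (ideal_pow I k) Q <-> is_ass (ideal_pow I k0) Q)
    /\ is_ass (ideal_pow I k0) P.

Definition vnum_at_is (I P : S -> Prop) (d : nat) : Prop :=
  (exists f : S, f \is d.-homog /\ same_set (colon I f) P) /\
  (forall d', (d' < d)%N ->
     ~ exists f : S, f \is d'.-homog /\ same_set (colon I f) P).

Definition vnum_is (I : S -> Prop) (d : nat) : Prop :=
  (exists f : S, f \is d.-homog /\ is_ass I (colon I f)) /\
  (forall d', (d' < d)%N ->
     ~ exists f : S, f \is d'.-homog /\ is_ass I (colon I f)).

End Ideals.

(* Main.v *)
Require Import Defs.
From HB Require Import structures.
From Stdlib Require Import Classical ClassicalEpsilon.
From mathcomp Require Import all_boot all_order all_algebra.
From mathcomp Require Import mpoly zify ring.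

(* Fix a prime P and put V_k = (I^k : P) and U_k = S ∩ I^k S_P.  A polynomial f
   satisfies (I^k : f) = P exactly when f lies in V_k but not in U_k.  Both
   families are stable under multiplication by I from degree k to k+1, and any
   nonzero h in P embeds (V_k) into the Rees algebra as k |-> h V_k ⊂ I^k; as the
   Rees algebra is noetherian, V_{k+1} = I V_k for k >= k0.  With homogeneous
   generators g_j of I and h_i of V_{k0}, the ideal V_k is spanned by the products
   g^a h_i with |a| = k - k0, and because U_k is an ideal the least degree in
   V_k \ U_k is attained by such a product.  For each i the exponents a with
   g^a h_i in U form an up-closed set; by Dickson's lemma its complement is a
   finite union of cells, on each of which the least degree is linear in k.  A
   minimum of finitely many linear functions is eventually linear.

   For v(I^k) itself one minimizes over the primes associated to some power of I.
   There are finitely many of them, since each is the contraction to S of an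
   annihilator in the associated graded ring of I, a quotient of the Rees algebra. *)

Set Implicit Arguments.
Unset Strict Implicit.
Unset Printing Implicit Defensive.

Import Order.TTheory GRing.Theory Num.Theory.
Local Open Scope ring_scope.

(** * Noetherian rings *)

Definition ideal_of (A : comNzRingType) (J : A -> Prop) : Prop :=
  [/\ J 0, (forall x y, J x -> J y -> J (x + y)) & (forall a x, J x -> J (a * x))].

(** Membership is built up one multiple at a time, so an element of a generated ideal can be taken
    apart by induction. *)
Inductive gen (A : comNzRingType) (X : A -> Prop) : A -> Prop :=
| gen0 : gen X 0
| genMD a x y : X x -> gen X y -> gen X (a * x + y).

Definition noetherian (A : comNzRingType) : Prop :=
  forall J : A -> Prop, ideal_of J ->
  exists s : seq A, (forall x, x \in s -> J x) /\
                    (forall x, J x -> gen (fun y => y \in s) x).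

Section Gen.
Variable A : comNzRingType.
Implicit Types (J X Y : A -> Prop).

Lemma idealN J x : ideal_of J -> J x -> J (- x).
Proof. by case=> _ _ hM hx; rewrite -mulN1r; apply: hM. Qed.

Lemma idealB J x y : ideal_of J -> J x -> J y -> J (x - y).
Proof. by move=> hJ hx hy; case: (hJ) => _ hD _; apply: hD => //; apply: idealN. Qed.

Lemma ideal_sum J (T : eqType) (r : seq T) (F : T -> A) :
  ideal_of J -> (forall i, i \in r -> J (F i)) -> J (\sum_(i <- r) F i).
Proof.
case=> h0 hD _ hF; rewrite big_seq.
by elim/big_rec: _ => // i x /hF hi hx; apply: hD.
Qed.

Lemma gen_sub J X : ideal_of J -> (forall x, X x -> J x) ->
  forall x, gen X x -> J x.
Proof.
by case=> h0 hD hM hX x; elim=> // a y z /hX hy _ hz; apply: hD => //; apply: hM.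
Qed.

Lemma gen_mem X x : X x -> gen X x.
Proof. by move=> hx; rewrite -[x]mul1r -[_ * _]addr0; apply: genMD hx (gen0 _). Qed.

Lemma gen_ideal X : ideal_of (gen X).
Proof.
split; first exact: gen0.
- by move=> x y; elim=> [|a z t hz _ IH] hy; rewrite ?add0r // -addrA; apply: genMD (IH hy).
- move=> a x; elim=> [|b z t hz _ IH]; first by rewrite mulr0; apply: gen0.
  by rewrite mulrDr mulrA; apply: genMD.
Qed.

Lemma gen_mono X Y : (forall x, X x -> Y x) -> forall x, gen X x -> gen Y x.
Proof. by move=> h; apply: gen_sub (gen_ideal _) _ => x /h; apply: gen_mem. Qed.

End Gen.

Lemma noetherian_field (K : fieldType) : noetherian K.
Proof.
move=> J [h0 hD hM]; have [[x [hx nz]]|h] := classic (exists x, J x /\ x != 0).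
  exists [:: x]; split=> [y|y _]; first by rewrite inE => /eqP->.
  rewrite -[y]addr0 -[y](divfK nz); apply: genMD (gen0 _).
  by rewrite inE.
exists [::]; split=> // x hx; have [->|nz] := eqVneq x 0; first exact: gen0.
by case: h; exists x.
Qed.

Lemma noetherian_surj (A B : comNzRingType) (f : {rmorphism A -> B}) :
  (forall b, exists a, f a = b) -> noetherian A -> noetherian B.
Proof.
move=> surj nA J [h0 hD hM].
have [|s [sJ sgen]] := nA (fun a => J (f a)).
  split; first by rewrite rmorph0.
  - by move=> x y; rewrite rmorphD; apply: hD.
  - by move=> a x; rewrite rmorphM; apply: hM.
exists (map f s); split=> [_ /mapP[x /sJ hx ->] //|b].
have [a <-] := surj b => /sgen; elim=> [|c x y xs _ IH].
  by rewrite rmorph0; apply: gen0.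
by rewrite rmorphD rmorphM; apply: genMD => //; apply: map_f.
Qed.

(** * Maximal condition and noetherian induction *)

Section MaximalElements.
Variable A : comNzRingType.
Hypothesis nA : noetherian A.

(** Without a maximal member, choice yields a strictly ascending chain in [C]. Its union is an ideal
    whose finitely many generators all lie in one term, so the chain stops there. *)
Lemma noetherian_max (C : (A -> Prop) -> Prop) :
  (forall J, C J -> ideal_of J) -> (exists J, C J) ->
  exists2 J, C J & forall J', C J' -> (forall x, J x -> J' x) -> forall x, J' x -> J x.
Proof.
move=> Cid [J0 CJ0]; apply: NNPP => nomax.
have step (J : {J | C J}) : {J' : {J | C J} |
    (forall x, sval J x -> sval J' x) /\ exists x, sval J' x /\ ~ sval J x}.
  apply: constructive_indefinite_description; case: J => J CJ /=.
  apply: NNPP => h; apply: nomax; exists J => // J' CJ' sub x J'x.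
  apply: NNPP => nJx; apply: h; exists (exist _ J' CJ'); split=> //.
  by exists x.
pose c := fix c n := if n is n'.+1 then sval (step (c n')) else exist _ J0 CJ0.
have cS n x : sval (c n) x -> sval (c n.+1) x by case: (svalP (step (c n))) => + _; apply.
have cle n m x : (n <= m)%N -> sval (c n) x -> sval (c m) x.
  by move=> /subnK <-; elim: (m - n)%N => // k IH hx; rewrite addSn; apply/cS/IH.
have cid n := Cid _ (svalP (c n)).
have [|s [sU sgen]] := nA (J := fun x => exists n, sval (c n) x).
  split; first by exists 0%N; case: (cid 0%N).
  - move=> x y [p hx] [q hy]; exists (maxn p q); case: (cid (maxn p q)) => _ hD _.
    by apply: hD; [apply: cle hx|apply: cle hy]; rewrite ?leq_maxl ?leq_maxr.
  - by move=> a x [p hx]; exists p; case: (cid p) => _ _; apply.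
have [N hN] : exists N, forall x, x \in s -> sval (c N) x.
  elim: s sU {sgen} => [|y s IH] sU; first by exists 0%N.
  have [|N hN] := IH; first by move=> x xs; apply: sU; rewrite inE xs orbT.
  have [|M hM] := sU y; first by rewrite mem_head.
  exists (maxn N M) => x; rewrite inE => /orP[/eqP->|/hN].
    by apply: cle hM; apply: leq_maxr.
  by apply: cle; apply: leq_maxl.
case: (svalP (step (c N))) => _ [x [xS]]; apply; apply: gen_sub (cid N) hN _ _.
by apply: sgen; exists N.+1.
Qed.

Lemma noetherian_ind (Q : (A -> Prop) -> Prop) :
  (forall J, ideal_of J ->
     (forall J', ideal_of J' -> (forall x, J x -> J' x) ->
        (exists x, J' x /\ ~ J x) -> Q J') -> Q J) ->
  forall J, ideal_of J -> Q J.
Proof.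
move=> step J idJ; apply: NNPP => nQ.
have [||M [idM nQM] Mmax] := @noetherian_max (fun J => ideal_of J /\ ~ Q J).
- by move=> ? [].
- by exists J.
apply: nQM; apply: step => // J' idJ' sub [x [J'x nMx]]; apply: NNPP => nQ'.
by apply: nMx; apply: Mmax J'x.
Qed.

End MaximalElements.

(** * Hilbert's basis theorem *)

Section HilbertBasis.
Variable R : comNzRingType.
Hypothesis nR : noetherian R.

Section LeadingCoefficients.
Variable J : {poly R} -> Prop.
Hypothesis idJ : ideal_of J.

Definition lead_ideal (d : nat) (c : R) : Prop :=
  exists p : {poly R}, [/\ J p, (size p <= d.+1)%N & p`_d = c].

Lemma lead_ideal_ideal d : ideal_of (lead_ideal d).
Proof.
case: idJ => h0 hD hM; split.
- by exists 0; rewrite size_poly0 coef0.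
- move=> _ _ [p [Jp sp <-]] [q [Jq sq <-]]; exists (p + q); rewrite coefD; split=> //.
    exact: hD.
  by apply: leq_trans (size_polyD _ _) _; rewrite geq_max sp.
- move=> a _ [p [Jp sp <-]]; exists (a%:P * p); rewrite coefCM; split=> //.
    exact: hM.
  by rewrite mul_polyC; apply: leq_trans (size_scale_leq _ _) sp.
Qed.

Lemma lead_ideal_mono d e c : (d <= e)%N -> lead_ideal d c -> lead_ideal e c.
Proof.
case: idJ => h0 hD hM le [p [Jp sp <-]]; exists ('X^(e - d) * p); split.
- exact: hM.
- rewrite mulrC; apply: leq_trans (size_polyMleq _ _) _; rewrite size_polyXn; lia.
- by rewrite coefXnM ltnNge leq_subr /= subKn.
Qed.

(** The ideals [lead_ideal d] increase with [d]; finitely many generators of their union already lie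
    in one of them, which fixes [D]. *)
Lemma lead_ideal_stable : exists D, forall d c,
  lead_ideal d c -> lead_ideal (minn d D) c.
Proof.
have [|s [sU sgen]] := nR (J := fun c => exists d, lead_ideal d c).
  split; first by exists 0%N; case: (lead_ideal_ideal 0%N).
  - move=> x y [p hx] [q hy]; exists (maxn p q).
    case: (lead_ideal_ideal (maxn p q)) => _ hD _.
    by apply: hD; [apply: lead_ideal_mono hx|apply: lead_ideal_mono hy];
      rewrite ?leq_maxl ?leq_maxr.
  - by move=> a x [p hx]; exists p; case: (lead_ideal_ideal p) => _ _; apply.
have [D hD] : exists D, forall x, x \in s -> lead_ideal D x.
  elim: s sU {sgen} => [|y s IH] sU; first by exists 0%N.
  have [|N hN] := IH; first by move=> x xs; apply: sU; rewrite inE xs orbT.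
  have [|M hM] := sU y; first by rewrite mem_head.
  exists (maxn N M) => x; rewrite inE => /orP[/eqP->|/hN].
    by apply: lead_ideal_mono hM; apply: leq_maxr.
  by apply: lead_ideal_mono; apply: leq_maxl.
exists D => d c hc; rewrite /minn; case: ltnP => // _.
by apply: gen_sub (lead_ideal_ideal D) hD _ _; apply: sgen; exists d.
Qed.

Lemma lead_ideal_gens D : exists T : seq {poly R}, (forall p, p \in T -> J p) /\
  forall d, (d <= D)%N -> forall c, lead_ideal d c ->
    gen (fun c => exists p, [/\ p \in T, (size p <= d.+1)%N & p`_d = c]) c.
Proof.
have one d : exists T : seq {poly R}, (forall p, p \in T -> J p) /\
    forall c, lead_ideal d c ->
    gen (fun c => exists p, [/\ p \in T, (size p <= d.+1)%N & p`_d = c]) c.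
  have [s [sL sgen]] := nR (lead_ideal_ideal d).
  suff [T [TJ hT]] : exists T : seq {poly R}, (forall p, p \in T -> J p) /\
      forall c, c \in s -> exists p, [/\ p \in T, (size p <= d.+1)%N & p`_d = c].
    by exists T; split=> // c /sgen; apply: gen_mono.
  elim: s sL {sgen} => [|y s IH] sL; first by exists [::].
  have [|T [TJ hT]] := IH; first by move=> x xs; apply: sL; rewrite inE xs orbT.
  have [|p [Jp sp pd]] := sL y; first by rewrite mem_head.
  exists (p :: T); split=> [q|c]; rewrite inE => /orP[/eqP->//|].
  - exact: TJ.
  - by exists p; rewrite mem_head.
  - by move=> /hT[q [qT sq qd]]; exists q; rewrite inE qT orbT.
elim: D => [|D [T [TJ hT]]].
  by have [T [TJ hT]] := one 0%N; exists T; split=> // d; rewrite leqn0 => /eqP->.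
have [T' [TJ' hT']] := one D.+1; exists (T ++ T'); split=> [p|d].
  by rewrite mem_cat => /orP[/TJ|/TJ'].
rewrite leq_eqVlt => /orP[/eqP->|dD] c hc.
- apply: gen_mono (hT' _ hc) => b [p [pT sp pd]].
  by exists p; rewrite mem_cat pT orbT.
- apply: gen_mono (hT _ dD _ hc) => b [p [pT sp pd]].
  by exists p; rewrite mem_cat pT.
Qed.

End LeadingCoefficients.

Theorem hilbert_basis : noetherian {poly R}.
Proof.
move=> J idJ; have [D hD] := lead_ideal_stable idJ.
have [T [TJ hT]] := lead_ideal_gens idJ D; exists T; split=> //.
set G := gen _; have idG : ideal_of G := gen_ideal _.
suff main n (p : {poly R}) : (size p <= n)%N -> J p -> G p by move=> p; apply: main.
elim: n p => [|d IH] p.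
  by rewrite leqn0 size_poly_eq0 => /eqP-> _; case: idG.
move=> sp Jp; have hc : lead_ideal J d p`_d by exists p.
(* Generators of [lead_ideal (minn d D)] come from [T]; multiplying by ['X^(d - minn d D)] moves
   their leading coefficients to degree [d]. Subtracting [q] then lowers the size of [p]. *)
have [q [Gq sq qd]] : exists q : {poly R}, [/\ G q, (size q <= d.+1)%N & q`_d = p`_d].
  move: (hT _ (geq_minr d D) _ (hD _ _ hc)).
  elim=> [|a _ y [q [qT sq <-]] _ [r [Gr sr rd]]].
    by exists 0; rewrite size_poly0 coef0; case: idG.
  exists (a%:P * 'X^(d - minn d D) * q + r); split.
  - by apply: genMD.
  - apply: leq_trans (size_polyD _ _) _; rewrite geq_max sr andbT.
    rewrite -mulrA mul_polyC; apply: leq_trans (size_scale_leq _ _) _.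
    rewrite mulrC; apply: leq_trans (size_polyMleq _ _) _; rewrite size_polyXn; lia.
  - rewrite coefD rd -mulrA coefCM coefXnM ltnNge leq_subr /= subKn //.
    exact: geq_minl.
rewrite -[p](subrK q); case: (idG) => _ GD _; apply: GD => //; apply: IH.
  apply/leq_sizeP => j; rewrite leq_eqVlt coefB => /orP[/eqP<-|dj].
    by rewrite qd subrr.
  by rewrite !nth_default ?subrr // (leq_trans _ dj).
by apply: idealB => //; apply: gen_sub idJ TJ _ Gq.
Qed.

End HilbertBasis.

(** * Algebras of finite type over a noetherian ring *)

Definition subring_of (B : comNzRingType) (C : B -> Prop) : Prop :=
  [/\ C 0, (forall x y, C x -> C y -> C (x + y)) &
      (forall x y, C x -> C y -> C (x * y))].

(** The subalgebra of [B] generated by [gs] is replaced by an iterated polynomial ring [A] mapping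
    onto it. The last clause bounds the image of [phi] from above. *)
Lemma noetherian_adjoin (R B : comNzRingType) (f : {rmorphism R -> B}) (gs : seq B) :
  noetherian R ->
  exists (A : comNzRingType) (phi : {rmorphism A -> B}) (iota : {rmorphism R -> A}),
    [/\ noetherian A, (forall r, phi (iota r) = f r),
        (forall g, g \in gs -> exists a, phi a = g) &
        (forall C, subring_of C -> (forall r, C (f r)) ->
           (forall g, g \in gs -> C g) -> forall a, C (phi a))].
Proof.
move=> nR; elim: gs => [|g gs [A [phi [iota [nA pi him hC]]]]].
  by exists R, f, idfun; split.
have cg : commr_rmorph phi g by move=> x; apply: mulrC.
exists {poly A}, (horner_morph cg), (polyC \o iota : {rmorphism _ -> _}); split.
- exact: hilbert_basis.
- by move=> r; rewrite /= horner_morphC.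
- move=> h; rewrite inE => /orP[/eqP->|/him[a <-]].
    by exists 'X; rewrite /= horner_morphX.
  by exists a%:P; rewrite /= horner_morphC.
- move=> C hS Cf Cg; case: (hS) => C0 CD CM; elim/poly_ind => [|p c IH].
    by rewrite rmorph0.
  rewrite rmorphD rmorphM /= horner_morphX horner_morphC.
  apply: CD; first by apply: CM => //; apply: Cg; rewrite mem_head.
  by apply: hC => // h hgs; apply: Cg; rewrite inE hgs orbT.
Qed.

Lemma noetherian_mpoly (K : fieldType) n : noetherian {mpoly K[n]}.
Proof.
have [A [phi [iota [nA pi him hC]]]] :=
  @noetherian_adjoin K _ (@mpolyC n K : {rmorphism _ -> _}) [seq 'X_i | i : 'I_n]
    (@noetherian_field K).
apply: (noetherian_surj (f := phi)) nA; elim/mpolyind => [|c m p _ _ [b <-]].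
  by exists 0; rewrite rmorph0.
suff [a ha] : exists a, phi a = 'X_[m].
  by exists (iota c * a + b); rewrite rmorphD rmorphM ha pi /= mul_mpolyC.
rewrite mpolyXE_id; elim/big_ind: _ => [|_ _ [a <-] [a' <-]|i _].
- by exists 1; rewrite rmorph1.
- by exists (a * a'); rewrite rmorphM.
- have [|a ha] := him 'X_i; first by apply/imageP; exists i.
  by exists (a ^+ m i); rewrite rmorphXn /= ha.
Qed.

(* Noetherian induction: if [P0] is a contraction and [x1] is chosen with
   [(J : x1)] maximal among those contracting to [P0], then [(J : x1)] is prime,
   so that every prime contraction for [J] is either [P0] or one for
   [J + A x1]. *)
Lemma finitely_many_contractions (S A : comNzRingType) (iota : {rmorphism S -> A})
  (J : A -> Prop) : noetherian A -> ideal_of J ->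
  exists (N : nat) (T : nat -> S -> Prop), forall P : S -> Prop,
    ~ P 1 -> (forall a b, P (a * b) -> P a \/ P b) ->
    (exists x, forall s, J (iota s * x) <-> P s) ->
    exists2 i, (i < N)%N & forall s, P s <-> T i s.
Proof.
move=> nA; move: J; apply: noetherian_ind => // J idJ IH.
case: (classic (exists P : S -> Prop, [/\ ~ P 1, (forall a b, P (a * b) -> P a \/ P b)
    & exists x, forall s, J (iota s * x) <-> P s])); last first.
  move=> none; exists 0%N, (fun _ _ => True) => P P1 Pm Px.
  by case: none; exists P.
move=> [P0 [P01 P0m [x0 hx0]]].
have [J0 JD JM] := idJ.
pose C := fun L : A -> Prop => exists x, (forall s, J (iota s * x) <-> P0 s) /\
  forall a, L a <-> J (a * x).
have [||L [x1 [hx1 hL]] Lmax] := noetherian_max nA (C := C).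
- move=> L [x [_ hL]]; split.
  + by apply/hL; rewrite mul0r.
  + by move=> a b /hL ha /hL hb; apply/hL; rewrite mulrDl; apply: JD.
  + by move=> a b /hL hb; apply/hL; rewrite -mulrA; apply: JM.
- by exists (fun a => J (a * x0)), x0.
have P0M s u : P0 u -> P0 (u * s).
  by move=> /hx1 h; apply/hx1; rewrite rmorphM mulrAC mulrC; apply: JM.
(* If [u] is not in [L], then [(J : a x1)] strictly contains [L], so by maximality its contraction
   is not [P0]: some [s] outside [P0] has [s a x1] in [J]. Since [P0] is prime, [(J : s x1)] still
   contracts to [P0], hence equals [L]; but it contains [a]. *)
have Lprime u a : J (u * a * x1) -> ~ J (a * x1) -> J (u * x1).
  move=> hua na; apply: NNPP => nu.
  have [s [nPs Jsu]] : exists s, ~ P0 s /\ J (iota s * (a * x1)).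
    apply: NNPP => h; apply: nu; apply/hL.
    apply: (Lmax (fun b => J (b * (a * x1)))); last by rewrite mulrA.
    + exists (a * x1); split=> // s; split=> [hs|/hx1 hs].
        by apply: NNPP => nPs; apply: h; exists s.
      by rewrite mulrCA; apply: JM.
    + by move=> b /hL hb; rewrite mulrCA; apply: JM.
  apply: na; apply/hL; apply: (Lmax (fun b => J (b * (iota s * x1)))).
  + exists (iota s * x1); split=> // v; rewrite mulrA -rmorphM; split.
      by move=> /hx1/P0m[].
    by move=> hv; apply/hx1; apply: P0M.
  + by move=> b /hL hb; rewrite mulrCA; apply: JM.
  + by rewrite mulrCA.
have nx1 : ~ J x1 by move=> h; apply: P01; apply/hx1; rewrite rmorph1 mul1r.
have [||| N [T hT]] := IH (fun y => exists j a, J j /\ y = j + a * x1).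
- split; first by exists 0, 0; rewrite mul0r addr0.
  + move=> _ _ [j [a [Jj ->]]] [j' [a' [Jj' ->]]]; exists (j + j'), (a + a').
    by split; [apply: JD|ring].
  + move=> b _ [j [a [Jj ->]]]; exists (b * j), (b * a).
    by split; [apply: JM|ring].
- by move=> x Jx; exists x, 0; rewrite mul0r addr0.
- by exists x1; split=> //; exists 0, 1; rewrite mul1r add0r.
exists N.+1, (fun i => if i == N then P0 else T i) => P P1 Pm [x hx].
(* If some [s] outside [P] sends [x] into [J + A x1], then [s x] is congruent to [a x1] modulo [J],
   and primality of [(J : x1)] gives [P = P0]. Otherwise [x] has contraction [P] for [J + A x1] too,
   and the induction hypothesis applies. *)
case: (classic (exists s, ~ P s /\ exists j a, J j /\ iota s * x = j + a * x1)).
  move=> [s [nPs [j [a [Jj eq]]]]]; exists N; rewrite ?eqxx //.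
  have na : ~ J (a * x1).
    by move=> h; apply: nPs; apply/hx; rewrite eq; apply: JD.
  have red u : J (iota u * (iota s * x)) <-> J (iota u * a * x1).
    rewrite eq mulrDr mulrA; split=> h.
      rewrite -[_ * _ * _](addKr (iota u * j)) addrC.
      by apply: idealB => //; apply: JM.
    by apply: JD => //; apply: JM.
  move=> u; split=> hu.
    by apply/hx1; apply: Lprime na; apply/red; rewrite mulrCA; apply: JM; apply/hx.
  have /red : J (iota u * a * x1) by rewrite mulrAC mulrC; apply: JM; apply/hx1.
  by rewrite mulrA -rmorphM => /hx/Pm[].
move=> h; have [|i iN hi] := hT P P1 Pm.
  exists x => s; split=> [hs|/hx hs]; last by exists (iota s * x), 0; rewrite mul0r addr0.
  by apply: NNPP => nPs; apply: h; exists s.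
by exists i; [rewrite ltnS ltnW|rewrite ltn_eqF].
Qed.

(** * Powers of an ideal and the Rees algebra *)

Section IdealPowers.
Variables (K : fieldType) (n : nat).
Local Notation S := {mpoly K[n]}.
Implicit Types (I J L P : S -> Prop).

Lemma ideal_mul_ideal I J : is_ideal J -> is_ideal (ideal_mul I J).
Proof.
move=> [J0 JD JM]; split; first by exists [::]; rewrite big_nil.
- move=> _ _ [s [hs ->]] [t [ht ->]]; exists (s ++ t); rewrite big_cat; split=> // x.
  by rewrite mem_cat => /orP[/hs|/ht].
- move=> a _ [s [hs ->]]; exists [seq (x.1, a * x.2) | x <- s]; split.
    by move=> _ /mapP[x /hs[h1 h2] ->] /=; split=> //; apply: JM.
  by rewrite big_map mulr_sumr; apply: eq_bigr => x _ /=; rewrite mulrCA.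
Qed.

Lemma ideal_mul_mem I J x y : I x -> J y -> ideal_mul I J (x * y).
Proof.
move=> Ix Jy; exists [:: (x, y)]; rewrite big_seq1; split=> // z.
by rewrite inE => /eqP->.
Qed.

Lemma ideal_mul_sub I J L : is_ideal L ->
  (forall x y, I x -> J y -> L (x * y)) -> forall f, ideal_mul I J f -> L f.
Proof.
move=> idL h _ [s [hs ->]]; apply: (ideal_sum idL) => x /hs[]; exact: h.
Qed.

Lemma ideal_pow_ideal I k : is_ideal I -> is_ideal (ideal_pow I k).
Proof. by case: k => [|k] idI //=; apply: ideal_mul_ideal. Qed.

(** This reduces membership of a product to the case where one factor is a generator. *)
Lemma ideal_preim_mul I x : is_ideal I -> is_ideal (fun y => I (x * y)).
Proof.
move=> [h0 hD hM]; split; first by rewrite mulr0.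
- by move=> y z hy hz; rewrite mulrDr; apply: hD.
- by move=> a y hy; rewrite mulrCA; apply: hM.
Qed.

Lemma ideal_powD I i j x y : is_ideal I ->
  ideal_pow I i x -> ideal_pow I j y -> ideal_pow I (i + j) (x * y).
Proof.
move=> idI hx; elim: j y => [|j IH] y /=.
  by case: (ideal_pow_ideal i idI) => _ _ hM _; rewrite addn0 mulrC; apply: hM.
rewrite addnS /=; apply: ideal_mul_sub (ideal_preim_mul _ (ideal_mul_ideal _ idI)) _ _.
by move=> u v hu hv; rewrite mulrA; apply: ideal_mul_mem => //; apply: IH.
Qed.

Lemma ideal_pow_base I x : I x -> ideal_pow I 1 x.
Proof. by move=> Ix; rewrite -[x]mul1r; apply: ideal_mul_mem. Qed.

Lemma ideal_powX I x k : I x -> ideal_pow I k (x ^+ k).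
Proof. by move=> Ix; elim: k => // k IH; rewrite exprSr; apply: ideal_mul_mem. Qed.

Lemma ideal_pow_sub I k x : is_ideal I -> ideal_pow I k.+1 x -> I x.
Proof. by move=> idI; apply: ideal_mul_sub => // u v _; case: idI => _ _; apply. Qed.

Lemma prime_ext P Q : same_set P Q -> is_prime_ideal P -> is_prime_ideal Q.
Proof.
move=> eqPQ [[h0 hD hM] n1 hm]; split.
- split; first exact/eqPQ.
  + by move=> x y /eqPQ hx /eqPQ hy; apply/eqPQ; apply: hD.
  + by move=> a x /eqPQ hx; apply/eqPQ; apply: hM.
- by move=> /eqPQ.
- by move=> a b /eqPQ/hm[] h; [left|right]; apply/eqPQ.
Qed.

Lemma prime_mulN P a b : is_prime_ideal P -> ~ P a -> ~ P b -> ~ P (a * b).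
Proof. by move=> [_ _ h] na nb /h[]. Qed.

Lemma prime_common_multiplier P (T : eqType) (r : seq T) (Q : T -> S -> Prop) :
  is_prime_ideal P -> (forall t a s, Q t s -> Q t (a * s)) ->
  (forall t, t \in r -> exists2 s, ~ P s & Q t s) ->
  exists2 s, ~ P s & forall t, t \in r -> Q t s.
Proof.
move=> prP QM; elim: r => [|t r IH] h; first by exists 1 => //; case: prP.
have [|s ns hs] := IH; first by move=> u ur; apply: h; rewrite inE ur orbT.
have [|s' ns' hs'] := h t; first exact: mem_head.
exists (s * s'); first exact: prime_mulN.
move=> u; rewrite inE => /orP[/eqP->|/hs hu]; first exact: QM.
by rewrite mulrC; apply: QM.
Qed.

(** A maximal element among the ideals [(J : f)] with [f] outside [J] is prime. *)
Lemma exists_ass J : is_ideal J -> ~ J 1 -> exists P, is_ass J P.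
Proof.
move=> idJ nJ1; have [J0 JD JM] := idJ.
have idC f : is_ideal (colon J f).
  split; first by rewrite /colon mul0r.
  - by move=> x y hx hy; rewrite /colon mulrDl; apply: JD.
  - by move=> a x hx; rewrite /colon -mulrA; apply: JM.
have [||L [f [nJf hL]] Lmax] := @noetherian_max _ (@noetherian_mpoly K n)
    (fun L => exists f, ~ J f /\ same_set (colon J f) L).
- move=> L [f [_ hL]]; case: (idC f) => h0 hD hM; split; first exact/hL.
  + by move=> x y /hL hx /hL hy; apply/hL; apply: hD.
  + by move=> a x /hL hx; apply/hL; apply: hM.
- by exists (colon J 1), 1.
exists (colon J f); split; last by exists f.
split=> //; first by rewrite /colon mul1r.
move=> a b hab; case: (classic (colon J f b)) => [|nb]; [by right|left].
apply/hL; apply: (Lmax (colon J (b * f))).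
- by exists (b * f); split.
- by move=> x /hL hx; rewrite /colon mulrCA; apply: JM.
- by rewrite /colon mulrA.
Qed.

(** * The Rees algebra, stable filtrations and finiteness of the associated primes of powers *)

Section Rees.
Variable I : S -> Prop.
Hypothesis idI : is_ideal I.

(** The image of [phi] is the Rees algebra, the polynomials whose coefficient at each [k] lies in
    [I^k]; the last two clauses are the two inclusions. It is generated over [S] by the [g *: 'X]
    for [g] in a finite generating set of [I]. *)
Lemma rees_algebra :
  exists (A : comNzRingType) (phi : {rmorphism A -> {poly S}}) (iota : {rmorphism S -> A}),
    [/\ noetherian A, (forall r, phi (iota r) = r%:P),
        (forall k f, ideal_pow I k f -> exists a, phi a = f *: 'X^k) &
        (forall a k, ideal_pow I k (phi a)`_k)].
Proof.
have idP k := ideal_pow_ideal k idI.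
have [gs [gI ggen]] := @noetherian_mpoly K n I idI.
have [A [phi [iota [nA pi him hC]]]] :=
  noetherian_adjoin (polyC : {rmorphism S -> _}) [seq g *: 'X | g <- gs]
    (@noetherian_mpoly K n).
have him1 g : I g -> exists a, phi a = g *: 'X.
  move=> /ggen; elim=> [|c x y xs _ [b hb]]; first by exists 0; rewrite rmorph0 scale0r.
  have [|a ha] := him (x *: 'X); first by apply/mapP; exists x.
  exists (iota c * a + b); rewrite rmorphD rmorphM ha hb pi /=.
  by rewrite mul_polyC scalerA scalerDl.
exists A, phi, iota; split=> //.
- elim=> [|k IH] f /=; first by exists (iota f); rewrite pi expr0 alg_polyC.
  move=> [s [hs ->]]; elim: s hs => [|x s IHs] hs.
    by exists 0; rewrite rmorph0 big_nil scale0r.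
  have [|b hb] := IHs; first by move=> y ys; apply: hs; rewrite inE ys orbT.
  have [|/IH[a1 ha1] /him1[a2 ha2]] := hs x; first exact: mem_head.
  exists (a1 * a2 + b); rewrite rmorphD rmorphM ha1 ha2 hb big_cons scalerDl.
  by rewrite -scalerAl -scalerAr scalerA exprSr.
- apply: (hC (fun p => forall k, ideal_pow I k p`_k)).
  + split=> [k|p q hp hq k|p q hp hq k].
    * by rewrite coef0; case: (idP k).
    * by rewrite coefD; case: (idP k) => _ hD _; apply: hD.
    * rewrite coefM; apply: ideal_sum (idP k) _ => i _.
      by rewrite -{1}(subnKC (leq_ord i)); apply: ideal_powD.
  + by move=> r [|k]; rewrite //= coefC /=; case: (idP k.+1).
  + move=> _ /mapP[g /gI Ig ->] k; rewrite coefZ coefX.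
    by case: eqP => [->|_]; rewrite ?mulr1 ?mulr0; [apply: ideal_pow_base|case: (idP k)].
Qed.

Lemma filtration_powM (N : nat -> S -> Prop) :
  (forall k, is_ideal (N k)) -> (forall k x f, I x -> N k f -> N k.+1 (x * f)) ->
  forall i k x f, ideal_pow I i x -> N k f -> N (i + k)%N (x * f).
Proof.
move=> idN NS; elim=> [|i IH] k x f /= hx Nf.
  by case: (idN k) => _ _; apply.
have := ideal_preim_mul f (idN (i.+1 + k)%N) => idL.
rewrite mulrC; move: x hx; apply: ideal_mul_sub idL _ => u v hu hv.
by rewrite mulrC -mulrA addSnnS; apply: IH => //; apply: NS.
Qed.

(** The family [N] is an ideal of the Rees algebra, hence finitely generated. Beyond the degrees of
    the generators, every new element uses a cofactor of positive degree, from which a factor in [I]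
    splits off. *)
Lemma rees_submodule_stable (N : nat -> S -> Prop) :
  (forall k, is_ideal (N k)) -> (forall k f, N k f -> ideal_pow I k f) ->
  (forall k x f, I x -> N k f -> N k.+1 (x * f)) ->
  exists k0, forall k, (k0 <= k)%N -> forall f, N k.+1 f -> ideal_mul (N k) I f.
Proof.
move=> idN NP NS; have NM := filtration_powM idN NS.
have [A [phi [iota [nA pi him hC]]]] := rees_algebra.
have [|s [sN sgen]] := nA (fun a => forall k, N k (phi a)`_k).
  split=> [k|x y hx hy k|a x hx k].
  - by rewrite rmorph0 coef0; case: (idN k).
  - by rewrite rmorphD coefD; case: (idN k) => _ hD _; apply: hD.
  - rewrite rmorphM coefM; apply: (ideal_sum (idN k)) => i _.
    by rewrite -{1}(subnKC (leq_ord i)); apply: NM.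
exists (\max_(x <- s) size (phi x)) => k hk f Nf.
have idNI := ideal_mul_ideal (N k) idI.
have [a ha] := him _ _ (NP _ _ Nf).
suff : ideal_mul (N k) I (phi a)`_k.+1 by rewrite ha coefZ coefXn eqxx mulr1.
have /sgen : forall j, N j (phi a)`_j.
  move=> j; rewrite ha coefZ coefXn; case: eqP => [->|_]; rewrite ?mulr1 // mulr0.
  by case: (idN j).
elim=> [|c x y xs _ IH]; first by rewrite rmorph0 coef0; case: idNI.
rewrite rmorphD rmorphM coefD; case: (idNI) => _ hD _; apply: hD => //.
rewrite coefM; apply: (ideal_sum idNI) => i _.
case: (leqP (size (phi x)) (k.+1 - i)) => [le|lt].
  by rewrite [X in _ * X]nth_default // mulr0; case: idNI.
have : (size (phi x) <= k)%N by apply: leq_trans hk; apply: leq_bigmax_seq.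
(* Since [x] has size at most [k], its coefficient at [k.+1] vanishes, which excludes [i = 0]. For
   [i = j.+1] the cofactor lies in [I^j I]. *)
move=> sk; case: i lt => -[|j] ij lt.
  by have := leq_trans lt sk; rewrite subn0 ltnNge leqnSn.
rewrite mulrC; have := hC c j.+1 => /=.
apply: (ideal_mul_sub (ideal_preim_mul _ idNI)) => u v hu hv.
rewrite mulrA; apply: ideal_mul_mem => //; rewrite mulrC.
have kE : k = (j + (k.+1 - j.+1))%N by lia.
by rewrite {1}kE; apply: NM => //; apply: sN.
Qed.

(* [h] embeds the family [W] into the Rees algebra as a submodule. *)
Lemma filtration_stable (W : nat -> S -> Prop) (h : S) : h != 0 ->
  (forall k, is_ideal (W k)) -> (forall k f, W k f -> ideal_pow I k (h * f)) ->
  (forall k x f, I x -> W k f -> W k.+1 (x * f)) ->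
  exists k0, forall k, (k0 <= k)%N -> forall f, W k.+1 f -> ideal_mul (W k) I f.
Proof.
move=> nzh idW WP WS.
pose N k f := exists2 w, W k w & f = h * w.
have [|||k0 hk0] := @rees_submodule_stable N.
- move=> k; case: (idW k) => h0 hD hM; split; first by exists 0; rewrite ?mulr0.
  + by move=> _ _ [u hu ->] [v hv ->]; exists (u + v); rewrite ?mulrDr //; apply: hD.
  + by move=> a _ [u hu ->]; exists (a * u); rewrite 1?mulrCA //; apply: hM.
- by move=> k _ [w Ww ->]; apply: WP.
- by move=> k x _ Ix [w Ww ->]; exists (x * w); rewrite 1?mulrCA //; apply: WS.
exists k0 => k hk f Wf.
have [|s [hs eq]] := hk0 _ hk (h * f); first by exists f.
suff [t [ht eqt]] : exists t : seq (S * S), (forall x, x \in t -> W k x.1 /\ I x.2) /\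
    \sum_(x <- s) x.1 * x.2 = h * \sum_(x <- t) x.1 * x.2.
  by exists t; split=> //; apply: (mulfI nzh); rewrite -eqt -eq.
elim: s hs {eq} => [|x s IH] hs; first by exists [::]; rewrite !big_nil mulr0.
have [|t [ht eqt]] := IH; first by move=> y ys; apply: hs; rewrite inE ys orbT.
have [|[w Ww x1] Ix] := hs x; first exact: mem_head.
exists ((w, x.2) :: t); split=> [y|]; first by rewrite inE => /orP[/eqP->|/ht].
by rewrite !big_cons /= eqt mulrDr x1 mulrA.
Qed.

(* [Ass(S/I^(k+1))] is contained in the union of [Ass(S/I^k)] and [Ass(I^k/I^(k+1))], and the
   latter primes are contractions of annihilators in the associated graded ring. *)
Lemma ass_pow_finite : exists (N : nat) (T : nat -> S -> Prop), forall k P,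
  is_ass (ideal_pow I k) P -> exists2 i, (i < N)%N & same_set P (T i).
Proof.
have idP k := ideal_pow_ideal k idI.
have [A [phi [iota [nA pi him hC]]]] := rees_algebra.
(* This ideal is the preimage of [I] times the Rees algebra, so the quotient of [A] by it is the
   associated graded ring. *)
have [|N [T hT]] := @finitely_many_contractions _ _ iota
    (fun a => forall k, ideal_pow I k.+1 (phi a)`_k) nA.
  split=> [k|x y hx hy k|a x hx k].
  - by rewrite rmorph0 coef0; case: (idP k.+1).
  - by rewrite rmorphD coefD; case: (idP k.+1) => _ hD _; apply: hD.
  - rewrite rmorphM coefM; apply: ideal_sum (idP k.+1) _ => i _.
    rewrite -{1}(subnKC (leq_ord i)) -addnS; exact: ideal_powD.
exists N, T => k P; elim: k => [|k IH] [prP [f hf]].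
  by case: prP => _ nP1 _; case: nP1; apply/hf.
(* If [s f] lies in [I^k] for some [s] outside [P], its class in [I^k/I^(k+1)] has annihilator [P].
   Otherwise [(I^k : f) = P] already. *)
case: (classic (exists s, ~ P s /\ ideal_pow I k (s * f))) => [[s [ns hs]]|h].
  case: (prP) => _ nP1 Pm; apply: hT => //.
  have [a ha] := him _ _ hs; exists a => u.
  have -> : phi (iota u * a) = (u * (s * f)) *: 'X^k.
    by rewrite rmorphM pi ha mul_polyC scalerA.
  split=> [/(_ k)|Pu j].
    rewrite coefZ coefXn eqxx mulr1 mulrA => hu.
    by have /Pm[] : P (u * s) by apply/hf.
  rewrite coefZ coefXn; case: eqP => [->|_]; rewrite ?mulr0 ?mulr1; last by case: (idP j.+1).
  by rewrite mulrCA; case: (idP k.+1) => _ _; apply; apply/hf.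
apply: IH; split=> //; exists f => s; split=> [hs|/hf].
  by apply: NNPP => ns; apply: h; exists s.
by apply: ideal_mul_sub (idP k) _ _ => u v hu _; rewrite mulrC; case: (idP k) => _ _; apply.
Qed.

End Rees.
End IdealPowers.

(** * Minima over complements of up-closed sets of exponents *)

Definition least (D : nat -> Prop) (d : nat) : Prop :=
  D d /\ forall d', (d' < d)%N -> ~ D d'.

(** The intercept may be negative, hence integer coefficients; the sign condition makes [absz] a
    faithful conversion. *)
Definition eventually_linear_min (D : nat -> nat -> Prop) : Prop :=
  exists (a b : int) (k0 : nat), forall k : nat, (k0 <= k)%N ->
    0 <= a * k%:Z + b /\ least (D k) (absz (a * k%:Z + b)).

Definition eventually_empty (D : nat -> nat -> Prop) : Prop :=
  exists k0, forall k, (k0 <= k)%N -> forall d, ~ D k d.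

(* [D k] is the set of degrees realized at the [k]-th power. *)
Definition tame (D : nat -> nat -> Prop) : Prop :=
  eventually_empty D \/ eventually_linear_min D.

(** For [k >= k0] both families are empty together and have the same minimum, so degrees may be
    thinned out to convenient ones. *)
Lemma tame_dom (D D' : nat -> nat -> Prop) k0 :
  (forall k, (k0 <= k)%N -> forall d, D' k d -> D k d) ->
  (forall k, (k0 <= k)%N -> forall d, D k d -> exists2 d', (d' <= d)%N & D' k d') ->
  tame D' -> tame D.
Proof.
move=> sub dom [[k1 h]|[a [b [k1 h]]]].
  left; exists (maxn k0 k1) => k; rewrite geq_max => /andP[hk0 hk1] d Dd.
  by have [d' _] := dom _ hk0 _ Dd; apply: h.
right; exists a, b, (maxn k0 k1) => k; rewrite geq_max => /andP[hk0 hk1].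
have [ge0 [Dk minD]] := h _ hk1; split=> //; split; first exact: sub.
move=> d' lt Dd'; have [d'' le D''] := dom _ hk0 _ Dd'.
by apply: minD D''; apply: leq_ltn_trans lt.
Qed.

Lemma tame_ext (D D' : nat -> nat -> Prop) :
  (forall k d, D k d <-> D' k d) -> tame D' -> tame D.
Proof.
move=> eqD; apply: (@tame_dom _ _ 0%N) => k _ d /eqD // Dd.
by exists d.
Qed.

Lemma linear_compare (a1 b1 a2 b2 : int) :
  exists k0, (forall k : nat, (k0 <= k)%N -> a1 * k%:Z + b1 <= a2 * k%:Z + b2) \/
             (forall k : nat, (k0 <= k)%N -> a2 * k%:Z + b2 <= a1 * k%:Z + b1).
Proof.
case: (ltgtP a1 a2) => [lt|lt|->].
(* Distinct integer slopes differ by at least one, so the difference of the intercepts is overtaken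
   by then. *)
- exists (absz (b1 - b2)); left=> k hk.
  have : b1 - b2 <= k%:Z by lia.
  by nia.
- exists (absz (b1 - b2)); right=> k hk.
  have : b2 - b1 <= k%:Z by lia.
  by nia.
- by exists 0%N; case: (leP b1 b2) => h; [left|right] => k _; lia.
Qed.

Lemma tame_union (D1 D2 : nat -> nat -> Prop) :
  tame D1 -> tame D2 -> tame (fun k d => D1 k d \/ D2 k d).
Proof.
case=> [[k1 h1]|h1].
  apply: (@tame_dom _ D2 k1); first by move=> k _ d; right.
  by move=> k hk d [Dd|]; [case: (h1 k hk d)|exists d].
case=> [[k2 h2]|h2].
  apply: (@tame_dom _ D1 k2); last by right.
    by move=> k _ d; left.
  by move=> k hk d [|Dd]; [exists d|case: (h2 k hk d)].
case: h1 h2 => [a1 [b1 [k1 h1]]] [a2 [b2 [k2 h2]]].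
have [k3 cmp] := linear_compare a1 b1 a2 b2; right.
wlog le : D1 D2 a1 b1 k1 h1 a2 b2 k2 h2 cmp /
    forall k : nat, (k3 <= k)%N -> a1 * k%:Z + b1 <= a2 * k%:Z + b2.
  move=> main; case: (cmp) => h.
    by apply: main h1 _ _ _ h2 _ _.
  have [a [b [k0 hk]]] : eventually_linear_min (fun k d => D2 k d \/ D1 k d).
    by apply: main h2 _ _ _ h1 _ _ => //; left.
  exists a, b, k0 => k /hk[ge0 [Dk minD]]; split=> //; split.
    by case: Dk; [right|left].
  by move=> d' /minD nD [|] Dd'; apply: nD; [right|left].
exists a1, b1, (maxn k1 (maxn k2 k3)) => k; rewrite !geq_max => /and3P[hk1 hk2 hk3].
have [ge1 [Dk1 min1]] := h1 _ hk1; have [ge2 [Dk2 min2]] := h2 _ hk2.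
have := le _ hk3 => lek; split=> //; split; first by left.
by move=> d' lt [/min1|/min2]; apply; lia.
Qed.

Lemma tame_finite (T : finType) (D : T -> nat -> nat -> Prop) :
  (forall i, tame (D i)) -> tame (fun k d => exists i, D i k d).
Proof.
move=> hD; apply: (@tame_ext _ (fun k d => exists2 i, i \in enum T & D i k d)).
  by move=> k d; split=> [[i Di]|[i _ Di]]; exists i; rewrite ?mem_enum.
elim: (enum T) => [|i r IH]; first by left; exists 0%N => k _ d [].
apply: tame_ext (tame_union (hD i) IH) => k d; split.
  by move=> [j]; rewrite inE => /orP[/eqP->|jr Dj]; [left|right; exists j].
by case=> [Di|[j jr Dj]]; [exists i|exists j]; rewrite ?inE ?eqxx ?jr ?orbT.
Qed.

Lemma uniform_bound (T : finType) (Q : T -> nat -> Prop) :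
  (forall x s s', (s <= s')%N -> Q x s -> Q x s') -> (forall x, exists s, Q x s) ->
  exists s, forall x, Q x s.
Proof.
move=> mono ex; suff [s hs] : exists s, forall x, x \in enum T -> Q x s.
  by exists s => x; apply: hs; rewrite mem_enum.
elim: (enum T) => [|x r [s hs]]; first by exists 0%N.
have [s' hs'] := ex x; exists (maxn s s') => y; rewrite inE => /orP[/eqP->|/hs].
  by apply: mono hs'; apply: leq_maxr.
by apply: mono; apply: leq_maxl.
Qed.

(** Exponent vectors are functions on [nat]; comparing only the first [m] values makes [E]
    independent of the others. *)
Definition upset (m : nat) (E : (nat -> nat) -> Prop) : Prop :=
  forall a b, (forall i, (i < m)%N -> (a i <= b i)%N) -> E a -> E b.

(* Dickson's lemma: exponents above [N] do not matter for membership. *)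
Lemma upset_truncate m E : upset m E ->
  exists N, forall a, E a -> E (fun i => minn (a i) N).
Proof.
elim: m E => [|m IH] E upE; first by exists 0%N => a; apply: upE.
pose slice s a := E (fun i => if i == m then s else a i).
have up_slice s : upset m (slice s).
  move=> a b le; apply: upE => i; rewrite ltnS leq_eqVlt.
  by case: eqP => //= _ /le.
have slice_mono s s' a : (s <= s')%N -> slice s a -> slice s' a.
  by move=> le; apply: upE => i _; case: eqP.
have [|Ninf hinf] := IH (fun a => exists s, slice s a).
  by move=> a b le [s hs]; exists s; apply: up_slice hs.
pose ext (b : {ffun 'I_m -> 'I_Ninf.+1}) i : nat :=
  if insub i is Some j then val (b j) else 0%N.
(* The union of the slices is decided by vectors bounded by [Ninf]. There are finitely many, so at
   one stage [s1] each that ever enters a slice has entered; from there on the slices are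
   constant. *)
have [||s1 hs1] := @uniform_bound {ffun 'I_m -> 'I_Ninf.+1}
    (fun b s => (exists s', slice s' (ext b)) -> slice s (ext b)).
- by move=> b s s' le h /h; apply: slice_mono.
- move=> b; case: (classic (exists s', slice s' (ext b))) => [[s hs]|h].
    by exists s.
  by exists 0%N => /h.
have stable s a : slice s a -> slice (minn s s1) a.
  move=> hs; rewrite /minn; case: ltnP => // _.
  have [|s' hs'] := hinf a; first by exists s.
  pose b := [ffun i : 'I_m => inord (minn (a i) Ninf) : 'I_Ninf.+1].
  have bE i : (i < m)%N -> ext b i = minn (a i) Ninf.
    by move=> im; rewrite /ext insubT ffunE /= inordK // ltnS geq_minr.
  apply: (@up_slice _ (ext b)); first by move=> i /bE->; apply: geq_minl.
  apply: hs1; exists s'; apply: up_slice hs' => i /bE-> //.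
have [||N' hN'] := @uniform_bound 'I_s1.+1
    (fun s N => forall a, slice s a -> slice s (fun i => minn (a i) N)).
- by move=> s N N' le h a /h; apply: up_slice => i _; rewrite leq_min geq_minl (leq_trans (geq_minr _ _)).
- by move=> s; apply: IH.
exists (maxn N' s1) => a Ea.
have /stable Es : slice (a m) a by apply: upE Ea => i _; case: eqP => // ->.
have := hN' (inord (minn (a m) s1)) a; rewrite inordK ?ltnS ?geq_minr // => /(_ Es).
apply: upE => i _.
by case: eqP => [->|_]; lia.
Qed.

(** A cell collects the exponents with a given truncation [b] at [N]: coordinates with [b i < N] are
    fixed, the others range freely from [N] upwards. Without free coordinates the total is constant
    and the cell is eventually empty; otherwise the minimum puts all the excess on a free coordinate
    of least weight, which is the slope. *)
Lemma tame_downset m E (d : nat -> nat) (c k0 : nat) : upset m E ->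
  tame (fun k e => exists a, [/\ ~ E a, (\sum_(i < m) a i + k0 = k)%N &
                                 (e = \sum_(i < m) d i * a i + c)%N]).
Proof.
move=> upE; have [N trE] := upset_truncate upE.
pose cell (b : {ffun 'I_m -> 'I_N.+1}) (a : nat -> nat) :=
  forall i : 'I_m, minn (a i) N = b i.
pose D (b : {ffun 'I_m -> 'I_N.+1}) k e := exists a, [/\ cell b a, ~ E a,
  (\sum_(i < m) a i + k0 = k)%N & (e = \sum_(i < m) d i * a i + c)%N].
apply: (@tame_ext _ (fun k e => exists b, D b k e)).
  move=> k e; split=> [[a [nE sa ea]]|[b [a [_ nE sa ea]]]]; last by exists a.
  exists [ffun i : 'I_m => inord (minn (a i) N)], a; split=> // i.
  by rewrite ffunE inordK // ltnS geq_minr.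
apply: tame_finite => b.
case: (classic (exists a, cell b a /\ ~ E a)) => [[a0 [ca0 nE0]]|none]; last first.
  by left; exists 0%N => k _ e [a [ca nE _ _]]; apply: none; exists a.
(* By the choice of [N], a cell that meets the complement of [E] lies inside it. *)
have cellE a : cell b a -> ~ E a.
  move=> ca /trE Ea; apply: nE0; apply: upE Ea => i im.
  by rewrite (ca (Ordinal im)) -(ca0 (Ordinal im)) geq_minl.
case: (pickP (fun j : 'I_m => b j == N :> nat)) => [j0 bj0|nofree]; last first.
  left; exists (\sum_(i < m) b i + k0).+1 => k hk e [a [ca _ sa _]].
  have eqs : (\sum_(i < m) a i = \sum_(i < m) b i)%N.
    by apply: eq_bigr => i _; have := ca i; have := nofree i => /= /eqP; lia.
  by move: hk; rewrite -sa eqs ltnn.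
pose j := [arg min_(j < j0 | b j == N :> nat) d j].
have [bj jmin] : b j == N :> nat /\ forall i, b i == N :> nat -> (d j <= d i)%N.
  by rewrite /j; case: arg_minnP.
set sb := (\sum_(i < m) b i)%N; set wb := (\sum_(i < m) d i * b i)%N.
right; exists (d j)%:Z, ((wb + c)%:Z - (d j * (k0 + sb))%:Z), (k0 + sb)%N => k hk.
have valE : (d j)%:Z * k%:Z + ((wb + c)%:Z - (d j * (k0 + sb))%:Z)
    = (wb + d j * (k - (k0 + sb)) + c)%:Z by nia.
rewrite valE; split=> //; rewrite absz_nat; split.
  pose x := (k - (k0 + sb))%N.
  pose a i := (if insub i is Some i' then val (b i') + (i' == j) * x else 0)%N.
  have aE (i : 'I_m) : a i = (b i + (i == j) * x)%N by rewrite /a valK.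
  have ca : cell b a.
    move=> i; rewrite aE; case: eqP => [->|_].
      by rewrite (eqP bj); apply/minn_idPr; apply: leq_addr.
    by rewrite mul0n addn0; apply/minn_idPl; rewrite -ltnS.
  exists a; split=> //; first exact: cellE.
  - have -> : (\sum_(i < m) a i = sb + x)%N.
      rewrite (eq_bigr (fun i : 'I_m => b i + (i == j) * x)%N) => [|i _]; last exact: aE.
      rewrite big_split /= -big_distrl /=; congr (_ + _)%N.
      by rewrite (bigD1 j) //= eqxx big1 ?mul1n // => i /negPf->.
    by rewrite /x; lia.
  - rewrite (eq_bigr (fun i : 'I_m => d i * b i + (d i * (i == j)) * x)%N); last first.
      by move=> i _; rewrite aE mulnDr mulnA.
    rewrite big_split /= -big_distrl /=; congr (_ + _ + _)%N.
    by rewrite (bigD1 j) //= eqxx muln1 big1 ?addn0 // => i /negPf->; rewrite muln0.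
move=> e lt [a [ca _ sa ea]].
(* This is the sum of [(d i - d j) * (a i - b i) >= 0], written without subtraction: at a free
   coordinate both factors are nonnegative, at a fixed one [a i = b i]. *)
have : (\sum_(i < m) (d i * b i + d j * a i) <= \sum_(i < m) (d i * a i + d j * b i))%N.
  apply: leq_sum => i _; have := ca i; case: (eqVneq (b i : nat) N) => [bN|bN] aN.
    have le : (b i <= a i)%N by rewrite -aN geq_minl.
    have := jmin i; rewrite bN eqxx => /(_ isT) dle; rewrite -bN.
    move: le dle; move: (a i) (nat_of_ord (b i)) (d i) (d j) => p q u v; nia.
  suff -> : a i = b i by [].
  by move: aN bN; rewrite /minn; case: ltnP => // _ <-; rewrite eqxx.
rewrite !big_split /= -!big_distrr /= -/sb -/wb => le.
clear valE ca; clearbody sb wb j.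
move: lt hk; rewrite ea -sa => lt hk; have {hk} : (sb <= \sum_(i < m) a i)%N by lia.
move=> /subnK eqs; move: lt le; rewrite -eqs.
have -> : (\sum_(i < m) a i - sb + sb + k0 - (k0 + sb) = \sum_(i < m) a i - sb)%N by lia.
rewrite mulnDr.
move: (\sum_(i < m) a i)%N (\sum_(i < m) d i * a i)%N (d j * _)%N => p q r.
by lia.
Qed.

(** * Graded ideals *)

Section GradedIdeals.
Variables (K : fieldType) (n : nat).
Local Notation S := {mpoly K[n]}.
Local Notation pi := (pihomog mdeg).
Implicit Types (I J P : S -> Prop) (x y f : S).

Lemma pihomog_sum d (T : Type) (r : seq T) (F : T -> S) :
  pi d (\sum_(i <- r) F i) = \sum_(i <- r) pi d (F i).
Proof. exact: linear_sum. Qed.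

Lemma pihomog_large d x : (msize x <= d)%N -> pi d x = 0.
Proof.
move=> le; rewrite pihomogE big_seq_cond big_pred0 // => m.
apply/negP => /andP[/msize_mdeg_lt mx /eqP md].
by move: (leq_trans mx le); rewrite md ltnn.
Qed.

Lemma pihomog_homogM e d x y : x \is e.-homog ->
  pi d (x * y) = if (e <= d)%N then x * pi (d - e) y else 0.
Proof.
move=> hx; rewrite {1}[y](pihomog_partitionE (leqnn (msize y))) mulr_sumr pihomog_sum.
have comp i : pi d (x * pi i y) = if (e + i)%N == d then x * pi i y else 0.
  have hxy : x * pi i y \is (e + i).-homog by apply: dhomogM => //; apply: pihomogP.
  by case: eqP => [<-|/eqP ne]; [rewrite pihomog_dE|rewrite (pihomog_ne0 ne)].
under eq_bigr => i _ do rewrite comp.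
case: leqP => [le|lt]; last first.
  by rewrite big1 // => i _; case: eqP => //; lia.
rewrite -big_mkcond /=; case: (ltnP (d - e) (msize y)) => [lt|ge].
  rewrite (big_pred1 (Ordinal lt)) // => i /=; rewrite -val_eqE /=.
  by apply/eqP/eqP; lia.
rewrite pihomog_large // mulr0 big_pred0 // => i; have := ltn_ord i => lti.
by apply/eqP; lia.
Qed.

Lemma pihomog_topM d e x y : (msize x <= d.+1)%N -> (msize y <= e.+1)%N ->
  pi (d + e) (x * y) = pi d x * pi e y.
Proof.
move=> sx sy; rewrite {1}[x](pihomog_partitionE sx) mulr_suml pihomog_sum.
rewrite big_ord_recr big1 /= => [|i _]; last first.
  rewrite (pihomog_homogM _ _ (pihomogP _ _ _)); case: ifP => // _.
  rewrite [pi (_ - _) y]pihomog_large ?mulr0 //; have := ltn_ord i; lia.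
by rewrite add0r (pihomog_homogM _ _ (pihomogP _ _ _)) leq_addr addKn.
Qed.

Lemma msize_subtop d x : (msize x <= d.+1)%N -> (msize (x - pi d x) <= d)%N.
Proof.
move=> sx; rewrite {1}[x](pihomog_partitionE sx) big_ord_recr /= addrK.
apply: leq_trans (mmeasure_sum _ _ _ _) _; apply/bigmax_leqP => i _.
rewrite mmeasureE; apply/bigmax_leqP_seq => m hm _.
have /dhomogP := pihomogP (R := K) mdeg i x; move=> /(_ m hm) ->.
exact: ltn_ord.
Qed.

Lemma ideal_mul_graded I J : is_graded_ideal I -> is_graded_ideal J ->
  is_graded_ideal (ideal_mul I J).
Proof.
move=> [idI grI] [idJ grJ]; have idIJ := ideal_mul_ideal I idJ.
split=> // _ d [s [hs ->]]; rewrite pihomog_sum; apply: (ideal_sum idIJ) => x /hs[Ix Jx].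
rewrite {1}[x.1](pihomog_partitionE (leqnn (msize x.1))) mulr_suml pihomog_sum.
apply: (ideal_sum idIJ) => i _; rewrite (pihomog_homogM _ _ (pihomogP _ _ _)).
case: ifP => _; last by case: idIJ.
by apply: ideal_mul_mem; [apply: grI|apply: grJ].
Qed.

Lemma ideal_pow_graded I k : is_graded_ideal I -> is_graded_ideal (ideal_pow I k).
Proof. by move=> grI; elim: k => [|k IH] //=; apply: ideal_mul_graded. Qed.

Lemma graded_gens J : is_graded_ideal J ->
  exists (m : nat) (g : nat -> S) (d : nat -> nat),
    (forall i, (i < m)%N -> J (g i) /\ g i \is (d i).-homog) /\
    (forall f, J f -> gen (fun x => exists2 i, (i < m)%N & x = g i) f).
Proof.
move=> [idJ grJ]; have [s [sJ sgen]] := noetherian_mpoly idJ.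
pose L := [seq (d, pi d x) | x <- s, d <- iota 0 (msize x)].
have LP z : z \in L -> J z.2 /\ z.2 \is z.1.-homog.
  move=> /allpairsPdep[x [d [xs _ ->]]]; split; first by apply/grJ/sJ.
  exact: pihomogP.
exists (size L), (fun i => (nth (0%N, 0) L i).2), (fun i => (nth (0%N, 0) L i).1).
split=> [i iL|f /sgen]; first by apply: LP; apply: mem_nth.
apply: gen_sub (gen_ideal _) _ f => x xs.
rewrite [x](pihomog_partitionE (leqnn (msize x))).
apply: (ideal_sum (gen_ideal _)) => d _; apply: gen_mem.
have zL : (nat_of_ord d, pi d x) \in L.
  by apply/allpairsPdep; exists x, (nat_of_ord d); rewrite mem_iota /= add0n.
by exists (index (nat_of_ord d, pi d x) L); rewrite ?index_mem ?nth_index.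
Qed.

Lemma top_component_nilpotent J d a : is_graded_ideal J -> (msize a <= d.+1)%N ->
  forall m f r, (msize f <= m)%N -> J (a * (pi d a ^+ r * f)) ->
  exists r', J (pi d a ^+ r' * f).
Proof.
move=> [idJ grJ] sa; have [J0 JD JM] := idJ; set t := pi d a.
elim=> [|m IH] f r sf hf.
  by move: sf; rewrite leqn0 msize_poly_eq0 => /eqP->; exists 0%N; rewrite mulr0.
have htr : t ^+ r \is (d * r).-homog by apply/dhomogMn/pihomogP.
have top : J (t ^+ r.+1 * pi m f).
  have := grJ _ (d * r + (d + m))%N hf.
  by rewrite mulrCA (pihomog_homogM _ _ htr) leq_addr addKn pihomog_topM // exprSr mulrA.
have [||r' hr'] := IH (f - pi m f) r.+1; first exact: msize_subtop.
  rewrite mulrBr mulrBr; apply: idealB => //; last exact: JM.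
  by rewrite exprS -mulrA mulrCA; apply: JM.
exists (r' + r.+1)%N; rewrite -[f](subrK (pi m f)) mulrDr; apply: JD.
  by rewrite addnC exprD -mulrA; apply: JM.
by rewrite exprD -mulrA; apply: JM.
Qed.

(** A power of the top component of an element of [P] kills [f] modulo [J], so the top component is
    in the prime [P]; subtract it and repeat. *)
Lemma ass_graded J P : is_graded_ideal J -> is_ass J P -> is_graded_ideal P.
Proof.
move=> grJ [prP [f hf]]; have [idP nP1 Pm] := prP; split=> // a.
have PX x r : P (x ^+ r) -> P x.
  by elim: r => [|r IH]; rewrite ?expr0 // exprS => /Pm[//|/IH].
suff main D : forall a, (msize a <= D)%N -> P a -> forall d, P (pi d a).
  by move=> d /main; apply.
elim: D => [|D IH] {}a.
  by rewrite leqn0 msize_poly_eq0 => /eqP-> Pa d; rewrite pihomog0.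
move=> sa Pa; have Ptop : P (pi D a).
  have [|r hr] := @top_component_nilpotent J D a grJ sa _ f 0%N (leqnn _).
    by rewrite expr0 mul1r; apply/hf.
  by apply: (PX _ r); apply/hf.
move=> d; have Pb : P (a - pi D a) by apply: (@idealB S).
have := IH _ (msize_subtop sa) Pb d; rewrite pihomogB => Pd.
rewrite -[pi d a](subrK (pi d (pi D a))); case: (idP) => P0 PD _; apply: PD => //.
case: (eqVneq D d) => [<-|ne]; first by rewrite pihomog_id.
by rewrite (pihomog_ne0 ne) //; apply: pihomogP.
Qed.

(** Each component of [f] is multiplied into [J] by [P]. If none had colon ideal exactly [P], each
    would be sent into [J] by an element outside [P], and a common such multiplier would send [f]
    into [J]. *)
Lemma homog_witness J P : is_graded_ideal J -> is_ass J P ->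
  exists d f, f \is d.-homog /\ same_set (colon J f) P.
Proof.
move=> grJ assP; have [idP grP] := ass_graded grJ assP.
case: assP => prP [f hf]; case: (grJ) => idJ grJ'; have [J0 JD JM] := idJ.
have sub d x : P x -> J (x * pi d f).
  move=> Px; rewrite [x](pihomog_partitionE (leqnn (msize x))) mulr_suml.
  apply: (ideal_sum idJ) => i _; have := grJ' _ (i + d)%N (proj2 (hf (pi i x)) (grP _ _ Px)).
  by rewrite (pihomog_homogM _ _ (pihomogP _ _ _)) leq_addr addKn.
apply: NNPP => none.
have [||s ns hs] := @prime_common_multiplier _ _ P _ (iota 0 (msize f))
    (fun d s => J (s * pi d f)) prP.
- by move=> d a s hs; rewrite -mulrA; apply: JM.
- move=> d _; apply: NNPP => h; apply: none; exists d, (pi d f); split.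
    exact: pihomogP.
  move=> s; split; last exact: sub.
  by move=> hs; apply: NNPP => ns; apply: h; exists s.
apply: ns; apply/hf; rewrite /colon [f](pihomog_partitionE (leqnn (msize f))) mulr_sumr.
by apply: (ideal_sum idJ) => i _; apply: hs; rewrite mem_iota /= add0n.
Qed.

End GradedIdeals.

(** * The v-number *)

Section VNumber.
Variables (K : fieldType) (n : nat).
Local Notation S := {mpoly K[n]}.
Local Notation pi := (pihomog mdeg).
Variable I : S -> Prop.
Hypothesis grI : is_graded_ideal I.
Variable f0 : S.
Hypotheses (If0 : I f0) (nzf0 : f0 != 0).

Let idI : is_ideal I := proj1 grI.
Let idIk k : is_ideal (ideal_pow I k) := ideal_pow_ideal k idI.

(** * Degrees realized at a fixed prime *)

Section AtPrime.
Variable P : S -> Prop.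
Hypotheses (prP : is_prime_ideal P) (grP : is_graded_ideal P).
Variable h0 : S.
Hypotheses (Ph0 : P h0) (nzh0 : h0 != 0).

Definition colon_by k f := forall x, P x -> ideal_pow I k (x * f).

(* Membership in the localization [I^k S_P]. *)
Definition localized k f := exists2 s, ~ P s & ideal_pow I k (s * f).

Lemma colon_eq_prime k f :
  same_set (colon (ideal_pow I k) f) P <-> colon_by k f /\ ~ localized k f.
Proof.
split=> [hf|[Vf nU] s]; first by split=> [x /hf//|[s ns /hf]].
by split=> [hs|/Vf//]; apply: NNPP => ns; apply: nU; exists s.
Qed.

Lemma colon_by_ideal k : is_ideal (colon_by k).
Proof.
have [h0' hD hM] := idIk k; split.
- by move=> x _; rewrite mulr0.
- by move=> f g hf hg x Px; rewrite mulrDr; apply: hD; [apply: hf|apply: hg].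
- by move=> a f hf x Px; rewrite mulrCA; apply/hM/hf.
Qed.

Lemma colon_by_graded k : is_graded_ideal (colon_by k).
Proof.
split; first exact: colon_by_ideal.
move=> f d Vf x Px; rewrite [x](pihomog_partitionE (leqnn (msize x))) mulr_suml.
apply: (ideal_sum (idIk k)) => i _.
have := proj2 (ideal_pow_graded k grI) _ (i + d)%N (Vf _ (proj2 grP x i Px)).
by rewrite (pihomog_homogM _ _ (pihomogP _ _ _)) leq_addr addKn.
Qed.

Lemma localized_ideal k : is_ideal (localized k).
Proof.
have [h0' hD hM] := idIk k; split.
- by exists 1; [case: prP|rewrite mulr0].
- move=> f g [s ns hs] [t nt ht]; exists (s * t); first exact: prime_mulN.
  by rewrite mulrDr; apply: hD; [rewrite mulrAC mulrC|rewrite -mulrA]; apply: hM.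
- by move=> a f [s ns hs]; exists s => //; rewrite mulrCA; apply: hM.
Qed.

Lemma colon_byS k x f : I x -> colon_by k f -> colon_by k.+1 (x * f).
Proof.
by move=> Ix Vf y Py; rewrite mulrCA mulrC; apply: ideal_mul_mem => //; apply: Vf.
Qed.

Lemma localizedS k x f : I x -> localized k f -> localized k.+1 (x * f).
Proof.
by move=> Ix [s ns hs]; exists s => //; rewrite mulrCA mulrC; apply: ideal_mul_mem.
Qed.

Lemma tame_prime : tame (fun k d => exists f, f \is d.-homog /\
  same_set (colon (ideal_pow I k) f) P).
Proof.
have [k0 Vstable] : exists k0, forall k, (k0 <= k)%N ->
    forall f, colon_by k.+1 f -> ideal_mul (colon_by k) I f.
  apply: (filtration_stable idI nzh0 colon_by_ideal _ colon_byS) => k f; exact.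
have [m [g [d [gP ggen]]]] := graded_gens grI.
have [r [h [c [hP hgen]]]] := graded_gens (colon_by_graded k0).
pose mon (a : nat -> nat) := \prod_(j < m) g j ^+ a j : S.
have monD a b : mon (fun i => a i + b i)%N = mon a * mon b.
  by rewrite /mon -big_split; apply: eq_bigr => i _; rewrite exprD.
have mon_pow (a : nat -> nat) : ideal_pow I (\sum_(j < m) a j) (mon a).
  rewrite /mon; elim/big_rec2: _ => // i x p _ hp; apply: ideal_powD => //.
  by apply: ideal_powX; case: (gP i).
have mon_homog (a : nat -> nat) : mon a \is (\sum_(j < m) d j * a j).-homog.
  rewrite /mon; elim/big_rec2: _ => [|i x p _ hp]; first exact: dhomog1.
  by apply: dhomogM => //; apply: dhomogMn; case: (gP i).
have VM : forall (a : nat -> nat) i, (i < r)%N -> colon_by (\sum_(j < m) a j + k0) (mon a * h i).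
  move=> a i /hP[Vh _]; apply: (filtration_powM colon_by_ideal colon_byS) => //.
(* Products of [t] generators of [I] with one generator of [V_k0]; they span [V_(k0+t)] by
   stability. *)
pose X t x := exists (a : nat -> nat) i, [/\ (i < r)%N, (\sum_(j < m) a j = t)%N & x = mon a * h i].
have span t f : colon_by (k0 + t) f -> gen (X t) f.
  elim: t f => [|t IH] f.
    rewrite addn0 => /hgen; apply: gen_mono => _ [i ir ->].
    exists (fun=> 0%N), i; split=> //; first by rewrite big1.
    by rewrite /mon big1 ?mul1r // => j _; rewrite expr0.
  rewrite addnS => /(Vstable _ (leq_addr _ _)).
  apply: ideal_mul_sub (gen_ideal _) _ f => u v /IH hu /ggen hv.
  rewrite mulrC; move: u hu; apply: gen_sub (ideal_preim_mul v (gen_ideal _)) _.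
  move=> _ [a [i [ir sa ->]]]; rewrite mulrC; move: v hv.
  apply: gen_sub (ideal_preim_mul _ (gen_ideal _)) _ => _ [j jm ->].
  apply: gen_mem; exists (fun l => a l + (l == j))%N, i; split=> //.
    rewrite big_split /= sa (bigD1 (Ordinal jm)) //= eqxx big1 ?addn0 ?addn1 //.
    by move=> l; rewrite -val_eqE /= => /negPf->.
  rewrite monD mulrAC; congr (_ * _ * _).
  rewrite /mon (bigD1 (Ordinal jm)) //= eqxx expr1 big1 ?mulr1 //.
  by move=> l; rewrite -val_eqE /= => /negPf->; rewrite expr0.
pose E i (a : nat -> nat) := localized (\sum_(j < m) a j + k0) (mon a * h i).
have upE i : upset m (E i).
  move=> a b le; rewrite /E => Ea.
  have eqb : mon b = mon (fun j => b j - a j)%N * mon a.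
    rewrite -monD /mon; apply: eq_bigr => j _; rewrite subnK //; exact: le.
  have eqs : (\sum_(j < m) b j = \sum_(j < m) (b j - a j) + \sum_(j < m) a j)%N.
    by rewrite -big_split; apply: eq_bigr => j _; rewrite /= subnK // le.
  rewrite eqb eqs -addnA -mulrA.
  apply: (filtration_powM localized_ideal localizedS) Ea.
  exact: (mon_pow (fun j => b j - a j)%N).
(* Only the degrees of the products [g^a h_i] outside [U] are kept; exponents for each [i] form the
   complement of an up-closed set. *)
apply: (@tame_dom _ (fun k e => exists (i : 'I_r) (a : nat -> nat),
  [/\ ~ E i a, (\sum_(j < m) a j + k0 = k)%N &
      (e = \sum_(j < m) d j * a j + c i)%N]) k0); last first.
- by apply: tame_finite => i; apply: tame_downset.
- move=> k hk e [f [hf /colon_eq_prime[Vf nU]]]; apply: NNPP => none; apply: nU.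
  have genf : gen (X (k - k0)%N) f by apply: span; rewrite subnKC.
  (* In the degree [e] part of an expansion of [f], a term in [g^a h_i] vanishes if that product has
     degree above [e], and otherwise is a multiple of it. If all products of degree at most [e] were
     in [U], so would be [f]. *)
  rewrite -(pihomog_dE hf); elim: genf => [|s _ y [a [i [ir sa ->]]] _ IH].
    by rewrite pihomog0; case: (localized_ideal k).
  rewrite pihomogD; case: (localized_ideal k) => U0 UD UM; apply: UD => //.
  have hmon : mon a * h i \is (\sum_(j < m) d j * a j + c i).-homog.
    by apply: dhomogM => //; case: (hP _ ir).
  rewrite mulrC (pihomog_homogM _ _ hmon); case: ifP => // le.
  rewrite mulrC; apply: UM; apply: NNPP => nU.
  apply: none; exists (\sum_(j < m) d j * a j + c i)%N => //.
  by exists (Ordinal ir), a; rewrite /E /= sa subnK.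
- move=> k _ _ [i [a [nE <- ->]]]; exists (mon a * h i); split.
    by apply: dhomogM => //; case: (hP i).
  by apply/colon_eq_prime; split=> //; apply: VM.
Qed.

End AtPrime.

(** * Passage to stable primes and to the global v-number *)

Lemma tame_ass P k1 : is_ass (ideal_pow I k1) P ->
  tame (fun k d => exists f, f \is d.-homog /\ same_set (colon (ideal_pow I k) f) P).
Proof.
move=> assP; have grP := ass_graded (ideal_pow_graded k1 grI) assP.
case: assP => prP [f hf]; apply: (tame_prime prP grP (h0 := f0 ^+ k1)).
  apply/hf; rewrite /colon mulrC; case: (idIk k1) => _ _; apply; exact: ideal_powX.
exact: expf_neq0.
Qed.

(** Homogeneous witnesses at all large powers rule out the eventually empty alternative. *)
Lemma vnum_at_linear P k0 : (forall k, (k0 <= k)%N -> is_ass (ideal_pow I k) P) ->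
  eventually_linear_min (fun k d => exists f, f \is d.-homog /\
    same_set (colon (ideal_pow I k) f) P).
Proof.
move=> assP; have [[k1 none]|//] := tame_ass (assP _ (leqnn k0)).
have [d [f hf]] := homog_witness (ideal_pow_graded _ grI) (assP _ (leq_maxl k0 k1)).
by case: (none _ (leq_maxr k0 k1) d); exists f.
Qed.

Lemma vnum_linear : ~ I 1 -> eventually_linear_min (fun k d => exists f,
  f \is d.-homog /\ is_ass (ideal_pow I k) (colon (ideal_pow I k) f)).
Proof.
move=> nI1; have [N [T hT]] := ass_pow_finite idI.
(* Primality is built in because the sets [T i] are only known to include all associated primes of
   powers. *)
pose D P k d := is_prime_ideal P /\ exists f, f \is d.-homog /\
  same_set (colon (ideal_pow I k) f) P.
have tameD P : tame (D P).
  case: (classic (exists k, is_ass (ideal_pow I k) P)) => [[k assP]|none].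
    apply: tame_ext (tame_ass assP) => k' d; split=> [[]//|]; split=> //.
    by case: assP.
  by left; exists 0%N => k _ d [prP [f [_ hf]]]; apply: none; exists k; split=> //; exists f.
have [[k1 none]|//] : tame (fun k d => exists f, f \is d.-homog /\
    is_ass (ideal_pow I k) (colon (ideal_pow I k) f)).
  apply: tame_ext (tame_finite (fun i : 'I_N => tameD (T i))) => k d; split.
    move=> [f [hf assf]]; have [i iN eqT] := hT _ _ assf.
    exists (Ordinal iN); split; last by exists f.
    exact: prime_ext eqT (proj1 assf).
  move=> [i [prT [f [hf eqf]]]]; exists f; split=> //; split; last by exists f.
  by apply: prime_ext prT => s; split=> /eqf.
(* The exponent is positive, so this power lies in [I] and is proper. *)
have [|P assP] := exists_ass (idIk k1.+1).
  by move=> /(ideal_pow_sub idI).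
have [d [f [hf eqf]]] := homog_witness (ideal_pow_graded _ grI) assP.
case: (none k1.+1 (leqnSn _) d); exists f; split=> //; split; last by exists f.
by apply: prime_ext (proj1 assP) => s; split=> /eqf.
Qed.

End VNumber.

Theorem theorem3p1 (K : fieldType) (n : nat) (I : {mpoly K[n]} -> Prop) :
  is_graded_ideal I ->
  (exists f, I f /\ f != 0) ->
  ~ I 1 ->
  (forall P : {mpoly K[n]} -> Prop, is_stable_ass I P ->
     exists (a b : int) (k0 : nat), forall k : nat, (k0 <= k)%N ->
       0 <= a * k%:Z + b /\
       vnum_at_is (ideal_pow I k) P (absz (a * k%:Z + b))) /\
  (exists (a b : int) (k0 : nat), forall k : nat, (k0 <= k)%N ->
       0 <= a * k%:Z + b /\
       vnum_is (ideal_pow I k) (absz (a * k%:Z + b))).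
Proof.
move=> grI [f0 [If0 nzf0]] nI1; split; last exact: (vnum_linear grI If0 nzf0).
move=> P [k0 [stab assP]]; apply: (vnum_at_linear grI If0 nzf0 (k0 := k0)) => k hk.
exact/stab.
Qed.
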